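(* Let $q$ range over powers of odd primes. For extended reals $1\le u_1,u_2\le\infty$, let $LW_q(u_1,u_2)$ be the smallest constant (or $\infty$ if none exists) such that \[ \frac{1}{q^{3}}\sum_{(x_1,x_2,t)\in\mathbb{F}_q^3} f_1\big(x_2,\,t+\tfrac12 x_1x_2\big)\,f_2\big(x_1,\,t-\tfrac12 x_1x_2\big)\le LW_q(u_1,u_2)\,\|f_1\|_{L^{u_1}(\mathbb{F}_q^2,dx)}\|f_2\|_{L^{u_2}(\mathbb{F}_q^2,dx)} \] for all nonnegative $f_1,f_2:\mathbb{F}_q^2\to\mathbb{R}$. Then there is a constant $C>0$ independent of $q$ with $LW_q(u_1,u_2)\le C$ for all $q$ if and only if \[ \frac{1}{u_1}+\frac{2}{u_2}\le 2\quad\text{and}\quad \frac{2}{u_1}+\frac{1}{u_2}\le 2. \]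
   Context: The Heisenberg group $\mathbb{H}^1(\mathbb{F}_q)$ is $\mathbb{F}_q^3$ with product $(x,t)\cdot(x',t')=(x+x',\,t+t'+\tfrac12(x_1x_2'-x_2x_1'))$. The projections are $\pi_1(x_1,x_2,t)=(x_2,\,t+\tfrac12x_1x_2)$ and $\pi_2(x_1,x_2,t)=(x_1,\,t-\tfrac12x_1x_2)$, viewed as points of $\mathbb{F}_q^2$; the left-hand side above is $q^{-3}\sum_{(x,t)} f_1(\pi_1(x,t))f_2(\pi_2(x,t))$. Norms are normalized: $\|f\|_{L^r(\mathbb{F}_q^{m},dx)}=\big(q^{-m}\sum_{x\in\mathbb{F}_q^m}|f(x)|^r\big)^{1/r}$ for $r<\infty$, and $\|f\|_{L^\infty}=\max|f|$. *)

(* Defs.v *)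
From mathcomp Require Import all_boot all_order all_algebra.
From mathcomp Require Import all_classical all_reals all_analysis.

Set Implicit Arguments.
Unset Strict Implicit.
Unset Printing Implicit Defensive.

Import Order.TTheory GRing.Theory Num.Theory.

Local Open Scope classical_set_scope.
Local Open Scope ring_scope.

(* L^u norm for the normalized counting measure on a finite set T; for
   T = F_q^m the factor #|T|^-1 is q^-m. Only exponents 1 <= u are used, so the
   value at -oo is a dummy. *)
Definition normL (R : realType) (T : finType) (u : \bar R) (f : T -> R) : R :=
  match u with
  | r%:E => (#|T|%:R^-1 * \sum_(x : T) `|f x| `^ r) `^ r^-1
  | +oo%E => \big[Num.max/0]_(x : T) `|f x|
  | -oo%E => 0
  end.

(* The underlying set F^3 of the Heisenberg group; ((x1, x2), t) is its point
   with horizontal part (x1, x2) and vertical part t. *)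
Definition heis (F : finFieldType) : finType := (F * F * F)%type.

Definition hproj1 (F : finFieldType) (z : heis F) : F * F :=
  let: (x1, x2, t) := z in (x2, t + 2^-1 * x1 * x2).

Definition hproj2 (F : finFieldType) (z : heis F) : F * F :=
  let: (x1, x2, t) := z in (x1, t - 2^-1 * x1 * x2).

Definition LWform (R : realType) (F : finFieldType) (f1 f2 : F * F -> R) : R :=
  (#|F|%:R ^+ 3)^-1 * \sum_(z : heis F) f1 (hproj1 z) * f2 (hproj2 z).

Definition LWbound (R : realType) (F : finFieldType) (u1 u2 : \bar R) (A : R) :
    Prop :=
  forall f1 f2 : F * F -> R,
    (forall x, 0 <= f1 x) -> (forall x, 0 <= f2 x) ->
    LWform f1 f2 <= A * normL u1 f1 * normL u2 f2.

(* The set of admissible constants is closed and bounded below, so the infimum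
   is the smallest constant when there is one; it is +oo on the empty set. *)
Definition LW (R : realType) (F : finFieldType) (u1 u2 : \bar R) : \bar R :=
  ereal_inf [set A%:E | A in [set A : R | LWbound F u1 u2 A]].

(* Main.v *)
(** Write p = (x2, s) for points and l = (x1, c) for lines s = c + x1 x2, so that
    the form is q^-3 times the sum of f1(p) f2(l) over incident pairs (p, l).

    Sufficiency: at u1 = u2 = 3/2, Young's inequality reduces the bound to
    sum_l (sum_{p in l} k(p)^2)^3 <= 8 q (sum_p k(p)^3)^2.  On each line the cube
    is at most 4 (q sum_{p <> p'} k(p)^3 k(p')^3 + sum_p k(p)^6), and since two
    points lie on at most one line, while a point lies on q lines, summing over l
    gives the claim.  The exponents (1/u1, 1/u2) = (0,0), (1,0), (0,1) are
    trivial, and the allowed region is the convex hull of these three and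
    (2/3,2/3).  Once both norms are normalized to 1, interpolation is the
    pointwise bound F^a G^b <= 1 + F + G + (F G)^(2/3).

    Necessity: test on a point and the lines through it, and dually, over the
    fields F_p. *)
Require Import Defs.
From mathcomp Require Import ring lra fingroup cyclic.
From mathcomp Require Import all_boot all_order all_algebra.
From mathcomp Require Import all_classical all_reals all_analysis.

Set Implicit Arguments.
Unset Strict Implicit.

Import Order.TTheory GRing.Theory Num.Theory.
Local Open Scope ring_scope.

(** * Incidences between points and lines of the plane *)

Lemma natr_card_gt0 (R : realType) (F : finFieldType) : 0 < #|F|%:R :> R.
Proof. by rewrite ltr0n; apply/card_gt0P; exists 0. Qed.

Lemma sum_pair (R : realType) (I J : finType) (f : I * J -> R) :
  \sum_p f p = \sum_i \sum_j f (i, j).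
Proof. by rewrite pair_bigA; apply: eq_bigr => -[]. Qed.

(** The lines of a fixed slope partition the plane, so every point is counted once for each of the
    [#|F|] slopes. *)
Lemma sum_points_lines (R : realType) (F : finFieldType) (f : F * F -> R) :
  \sum_(l : F * F) \sum_(x : F) f (x, l.2 + l.1 * x) = #|F|%:R * \sum_p f p.
Proof.

have -> : #|F|%:R * (\sum_p f p) = \sum_(m : F) \sum_p f p.
  by rewrite sumr_const mulr_natl.
rewrite [LHS](sum_pair (fun l => \sum_x f (x, l.2 + l.1 * x))).
apply: eq_bigr => m _; rewrite sum_pair exchange_big /=.

apply: eq_bigr => x _.
by rewrite [RHS](reindex_inj (addIr (m * x))).
Qed.

(* Two points with distinct abscissas lie on exactly one line. *)
Lemma sum_pairs_lines (R : realType) (F : finFieldType) (f : F * F -> R) :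
  (forall p, 0 <= f p) ->
  \sum_(l : F * F) \sum_(x : F) \sum_(y | y != x)
    f (x, l.2 + l.1 * x) * f (y, l.2 + l.1 * y) <= (\sum_p f p) ^+ 2.
Proof.
move=> f0; rewrite exchange_big /=.
have -> : (\sum_p f p) ^+ 2 =
    \sum_(x : F) \sum_(y : F) \sum_(st : F * F) f (x, st.1) * f (y, st.2).
  rewrite sum_pair expr2 mulr_suml.
  apply: eq_bigr => x _; rewrite mulr_sumr; apply: eq_bigr => y _.
  rewrite sum_pair mulr_suml.
  by apply: eq_bigr => s _; rewrite mulr_sumr.
apply: ler_sum => x _; rewrite exchange_big /= [leRHS](bigID (fun y => y != x)) /=.
rewrite ler_wpDr //; first by do 2![apply: sumr_ge0 => ? _]; exact: mulr_ge0.
apply: ler_sum => y xy.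
(* A line is determined by its heights over [x] and [y]; the inverse of [h] interpolates them. *)
pose h (l : F * F) := (l.2 + l.1 * x, l.2 + l.1 * y).
rewrite [leRHS](reindex h) //=.
have yx : y - x != 0 by rewrite subr_eq0.
exists (fun st => ((st.2 - st.1) / (y - x), st.1 - (st.2 - st.1) / (y - x) * x)).
  by move=> [m c] _ /=; congr (_, _); field.
by move=> [s t] _; rewrite /h /=; congr (_, _); field.
Qed.

(** * The cubic estimate on one line and its sum over all lines *)

(** Sum the tangent inequality [3 * m * k ^+ 2 <= 2 * k ^+ 3 + m ^+ 3] with [m ^+ 2 = S2 / q];
    indices outside [P] only add terms [m ^+ 3]. *)
Lemma power_mean_le (R : realType) (I : finType) (P : pred I) (k : I -> R) :
  (forall x, 0 <= k x) ->
  (\sum_(x | P x) k x ^+ 2) ^+ 3 <= #|I|%:R * (\sum_(x | P x) k x ^+ 3) ^+ 2.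
Proof.
move=> k0; set S2 := \sum_(x | P x) _; set S3 := \sum_(x | P x) _.
have S20 : 0 <= S2 by apply: sumr_ge0 => x _; rewrite exprn_ge0.
have S30 : 0 <= S3 by apply: sumr_ge0 => x _; rewrite exprn_ge0.
have [I0|I0] := posnP #|I|.
  by rewrite I0 mul0r /S2 big_pred0 ?expr0n // => x; have := card0_eq I0 x.
set q := #|I|%:R : R; have q0 : 0 < q by rewrite ltr0n.
pose m := Num.sqrt (S2 / q).
have m0 : 0 <= m by exact: sqrtr_ge0.
have mE : S2 = q * m ^+ 2 by rewrite sqr_sqrtr ?divr_ge0 ?(ltW q0) // mulrC divfK ?gt_eqF.
have le3 : 3 * m * S2 <= 2 * S3 + q * m ^+ 3.
  have -> : q * m ^+ 3 = \sum_(x : I) m ^+ 3 by rewrite sumr_const mulr_natl.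
  apply: (@le_trans _ _ (2 * S3 + \sum_(x | P x) m ^+ 3)); last first.
    by rewrite lerD2l [leRHS](bigID P) /= lerDl; apply: sumr_ge0 => x _; rewrite exprn_ge0.
  rewrite !mulr_sumr -big_split /=; apply: ler_sum => x _.
  have : 0 <= (2 * k x + m) * (k x - m) ^+ 2.
    by rewrite mulr_ge0 ?sqr_ge0 // addr_ge0 // mulr_ge0.
  nra.
have le3' : q * m ^+ 3 <= S3 by rewrite mE in le3; nra.
rewrite mE (_ : _ ^+ 3 = q * (q * m ^+ 3) ^+ 2); last by ring.
by rewrite ler_pM2l // ler_sqr ?nnegrE // mulr_ge0 ?exprn_ge0 // ltW.
Qed.

(* Splitting off the largest value of k keeps the diagonal sum free of a
   factor #|I|, which Hoelder's inequality alone would produce. *)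
Lemma cube_sum_sqr_le (R : realType) (I : finType) (k : I -> R) :
  (forall x, 0 <= k x) ->
  (\sum_x k x ^+ 2) ^+ 3 <=
  4 * (#|I|%:R * (\sum_x \sum_(y | y != x) k x ^+ 3 * k y ^+ 3)
       + \sum_x k x ^+ 6).
Proof.
move=> k0.
have kn n x : 0 <= k x ^+ n by rewrite exprn_ge0.
have s0 (P : pred I) n : 0 <= \sum_(x | P x) k x ^+ n by apply: sumr_ge0.
have [x1|I0] := pickP [pred x : I | true]; last first.
  rewrite big_pred0 => [|x]; last exact: I0.
  rewrite expr0n mulr_ge0 // addr_ge0 // mulr_ge0 //.
  by do 2![apply: sumr_ge0 => ? _]; rewrite mulr_ge0.
move=> _; pose x0 := [arg max_(i > x1) k i]%O.
have kx0 x : k x <= k x0 by rewrite /x0; case: arg_maxP => // i _; exact.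
rewrite (bigD1 x0) //=; set b := \sum_(x | x != x0) k x ^+ 2.
have b0 : 0 <= b by exact: s0.
set a := k x0 ^+ 2; have a0 : 0 <= a by exact: kn.
have convex : (a + b) ^+ 3 <= 4 * (b ^+ 3 + a ^+ 3).
  have : 0 <= (a + b) * (a - b) ^+ 2 by rewrite mulr_ge0 ?sqr_ge0 ?addr_ge0.
  nra.
apply: le_trans convex _; rewrite ler_pM2l //; apply: lerD; last first.
  by rewrite -exprM (bigD1 x0) //= lerDl.
apply: le_trans (power_mean_le (fun x => x != x0) k0) _.
rewrite ler_wpM2l // expr2 mulr_suml.
rewrite [leRHS](bigID (fun x => x != x0)) /= ler_wpDr //.
  by do 2![apply: sumr_ge0 => ? _]; rewrite mulr_ge0.
apply: ler_sum => x xx0; rewrite -mulr_sumr ler_wpM2l //.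
rewrite (bigD1 x) //= [leRHS](bigD1 x0) /=; last by rewrite eq_sym.
apply: lerD; first by rewrite lerXn2r ?nnegrE.
by rewrite le_eqVlt; apply/predU1P; left; apply: eq_bigl => y; rewrite andbC.
Qed.

Lemma sum_lines_cube_le (R : realType) (F : finFieldType) (k : F * F -> R) :
  (forall p, 0 <= k p) ->
  \sum_(l : F * F) (\sum_(x : F) k (x, l.2 + l.1 * x) ^+ 2) ^+ 3 <=
  8 * #|F|%:R * (\sum_p k p ^+ 3) ^+ 2.
Proof.
move=> k0; set q := #|F|%:R : R; set S := \sum_p k p ^+ 3.
have q0 : 0 <= q by rewrite ler0n.
have k30 p : 0 <= k p ^+ 3 by rewrite exprn_ge0.
pose D := \sum_(l : F * F) \sum_(x : F) \sum_(y | y != x)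
    k (x, l.2 + l.1 * x) ^+ 3 * k (y, l.2 + l.1 * y) ^+ 3.
have DS : D <= S ^+ 2 by exact: (sum_pairs_lines k30).
have ES : \sum_p k p ^+ 6 <= S ^+ 2.
  rewrite expr2 mulr_suml; apply: ler_sum => p _.
  by rewrite (exprD _ 3 3) ler_wpM2l // /S (bigD1 p) //= lerDl sumr_ge0.
apply: (@le_trans _ _ (4 * (q * D + q * \sum_p k p ^+ 6))); last by nra.
(* Each point lies on [q] lines, so the sixth powers also become a sum over lines, and the claim can
   be checked line by line. *)
rewrite -(sum_points_lines (fun p => k p ^+ 6)) mulr_sumr -big_split mulr_sumr.
apply: ler_sum => l _.
exact: (@cube_sum_sqr_le _ _ (fun x => k (x, l.2 + l.1 * x))).
Qed.

(** * The form as an incidence sum, and its endpoint bound *)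

(** If 2 vanished, the additive order of 1 would divide both 2 and, by Lagrange, the odd number
    [#|F|]. *)
Lemma two_neq0_odd_card (F : finFieldType) : odd #|F| -> (2 : F) != 0.
Proof.
move=> oF; apply/negP => /eqP F2.
have o2 : (#[1%R : F]%g %| 2)%N by rewrite order_dvdn FinRing.zmodXgE F2.
have oc : (#[1%R : F]%g %| #|F|)%N by rewrite -cardsT order_dvdG ?inE.
have : (#[1%R : F]%g %| gcdn 2 #|F|)%N by rewrite dvdn_gcd o2.
rewrite (eqP (_ : coprime 2 #|F|)) ?coprime2n // dvdn1 order_eq1.
by rewrite -[1%g]/(0 : F) oner_eq0.
Qed.

(** Shifting [t] by half of [x1 * x2] straightens [hproj2] and puts the full product into
    [hproj1]. *)
Lemma LWform_lines (R : realType) (F : finFieldType) (f1 f2 : F * F -> R) :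
  odd #|F| ->
  LWform f1 f2 = (#|F|%:R ^+ 3)^-1 *
    \sum_(l : F * F) f2 l * \sum_(x : F) f1 (x, l.2 + l.1 * x).
Proof.
move=> oF; have F2 := two_neq0_odd_card oF.
rewrite /LWform; congr (_ * _); rewrite !sum_pair; apply: eq_bigr => m _.
under [RHS]eq_bigr do rewrite mulr_sumr.
rewrite [RHS]exchange_big /=; apply: eq_bigr => x _.
rewrite (reindex_inj (addIr (2^-1 * m * x))); apply: eq_bigr => c _ /=.
by rewrite addrK mulrC; congr (_ * f1 (_, _)); field.
Qed.

(** This is [u1 = u2 = 3/2]: the hypotheses say that [k ^+ 2] and [g ^+ 2] have norm at most 1, and
    writing squares keeps the exponents integral. *)
Lemma LWform_endpoint (R : realType) (F : finFieldType) (k g : F * F -> R) :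
  odd #|F| -> (forall p, 0 <= k p) -> (forall p, 0 <= g p) ->
  \sum_p k p ^+ 3 <= #|F|%:R ^+ 2 -> \sum_p g p ^+ 3 <= #|F|%:R ^+ 2 ->
  LWform (fun p => k p ^+ 2) (fun p => g p ^+ 2) <= 9.
Proof.
move=> oF k0 g0 kS gS; rewrite LWform_lines //.
have q0 : 0 < #|F|%:R :> R by exact: natr_card_gt0.
set q := #|F|%:R : R in q0 kS gS *.
rewrite ler_pdivrMl ?exprn_gt0 //.
pose Y (l : F * F) := \sum_(x : F) k (x, l.2 + l.1 * x) ^+ 2.
have Y0 l : 0 <= Y l by apply: sumr_ge0 => x _; rewrite exprn_ge0.
have young (a b : R) : 0 <= a -> 0 <= b -> a ^+ 2 * b <= a ^+ 3 + b ^+ 3.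
  move=> a0 b0; have := mulr_ge0 (addr_ge0 a0 b0) (sqr_ge0 (a - b)).
  have := exprn_ge0 3 a0; have := exprn_ge0 3 b0.
  have := mulr_ge0 (exprn_ge0 2 b0) a0.
  nra.
(* Young is applied to [g l] and the mean [Y l / q] over the line; the two sums are then at most
   [q ^+ 3] and [8 * q ^+ 3], whence 9. *)
apply: (@le_trans _ _ (\sum_l (q * g l ^+ 3 + q ^- 2 * Y l ^+ 3))).
  apply: ler_sum => l _; rewrite -/(Y l).
  have := young _ _ (g0 l) (divr_ge0 (Y0 l) (ltW q0)).
  rewrite -(ler_pM2l q0 (_ * (Y l / q))).
  rewrite (_ : q * (_ * (Y l / q)) = g l ^+ 2 * Y l); last first.
    by field; exact: lt0r_neq0.
  rewrite (_ : q * (_ + (Y l / q) ^+ 3) = q * g l ^+ 3 + q ^- 2 * Y l ^+ 3) //.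
  by field; exact: lt0r_neq0.
rewrite big_split -!mulr_sumr /=.
have hY := sum_lines_cube_le k0; rewrite -/q in hY.
have S2 : (\sum_p k p ^+ 3) ^+ 2 <= q ^+ 4.
  rewrite (exprM _ 2 2) lerXn2r ?nnegrE ?(exprn_ge0 _ (ltW q0)) //.
  by apply: sumr_ge0 => p _; rewrite exprn_ge0.
have h1 : q ^- 2 * \sum_l Y l ^+ 3 <= 8 * q ^+ 3.
  rewrite ler_pdivrMl ?exprn_gt0 //; apply: le_trans hY _.
  rewrite (_ : _ * (8 * _) = 8 * q * q ^+ 4); last by ring.
  by rewrite ler_pM2l ?mulr_gt0.
have h2 : q * \sum_l g l ^+ 3 <= q ^+ 3 by rewrite exprS ler_pM2l.
by lra.
Qed.

(** * Interpolation between the four corners *)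

(* (a, b) ranges over the convex hull of (0,0), (1,0), (0,1) and (2/3,2/3), so
   a x + b y is at most the largest of its values at these four points. *)
Lemma quadrilateral_le (R : realType) (a b x y : R) :
  0 <= a -> 0 <= b -> a + 2 * b <= 2 -> 2 * a + b <= 2 ->
  [\/ a * x + b * y <= 0, a * x + b * y <= x, a * x + b * y <= y |
      a * x + b * y <= (x + y) * (2 / 3)].
Proof.
move=> a0 b0 ab1 ab2.
have [x0|x0] := leP x 0.
  have [y0|y0] := leP y 0; first by apply: Or41; nra.
  by apply: Or43; nra.
have [y0|y0] := leP y 0; first by apply: Or42; nra.
have [xy|xy] := leP (2 * x) y.
  apply: Or43; nra.
have [yx|yx] := leP (2 * y) x.
  apply: Or42; nra.
apply: Or44; nra.
Qed.

Lemma powR_quadrilateral_le (R : realType) (a b F G : R) :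
  0 <= a -> 0 <= b -> a + 2 * b <= 2 -> 2 * a + b <= 2 -> 0 <= F -> 0 <= G ->
  F `^ a * G `^ b <= 1 + F + G + (F `^ 3^-1) ^+ 2 * (G `^ 3^-1) ^+ 2.
Proof.
move=> a0 b0 ab1 ab2 F0 G0.
have pow01 (c H : R) : 0 <= c <= 1 -> 0 <= H -> H `^ c <= 1 + H.
  move=> /andP[c0 c1] H0; apply: (@le_trans _ _ ((1 + H) `^ c)).
    by apply: ge0_ler_powR; rewrite ?nnegrE //; lra.
  by rewrite -[leRHS]powRr1 ?ler_powR //; lra.
have zero c : 0 <= c -> (0 : R) `^ c <= 1.
  rewrite le_eqVlt => /predU1P[<-|c0]; first by rewrite powRr0.
  by rewrite powR0 ?gt_eqF.
have [->|Fn0] := eqVneq F 0.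
  rewrite (@powR0 _ 3^-1) ?invr_eq0 // expr0n mul0r !addr0.
  have := pow01 b G; have := zero a a0; have := powR_ge0 G b; have := powR_ge0 0 a.
  nra.
have [->|Gn0] := eqVneq G 0.
  rewrite (@powR0 _ 3^-1) ?invr_eq0 // expr0n mulr0 !addr0.
  have := pow01 a F; have := zero b b0; have := powR_ge0 F a; have := powR_ge0 (0 : R) b.
  nra.
have {Fn0}F0 : 0 < F by rewrite lt_def Fn0.
have {Gn0}G0 : 0 < G by rewrite lt_def Gn0.
have F3 := powR_gt0 3^-1 F0; have G3 := powR_gt0 3^-1 G0.
have FG : 0 <= (F `^ 3^-1) ^+ 2 * (G `^ 3^-1) ^+ 2 by rewrite mulr_ge0 ?exprn_ge0 ?ltW.
have -> : F `^ a * G `^ b = expR (a * ln F + b * ln G).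
  by rewrite expRD /powR !gt_eqF.
have [h|h|h|h] := @quadrilateral_le R a b (ln F) (ln G) a0 b0 ab1 ab2;
  rewrite -ler_expR in h; apply: le_trans h _.
- by rewrite expR0; lra.
- by rewrite lnK ?posrE //; lra.
- by rewrite lnK ?posrE //; lra.
rewrite (_ : expR _ = (F `^ 3^-1) ^+ 2 * (G `^ 3^-1) ^+ 2); first by lra.
by rewrite /powR !gt_eqF // -!expRM_natl -expRD; congr expR; field.
Qed.

Lemma inve_ge1 (R : realType) (u : \bar R) : (1 <= u)%E ->
  exists2 a : R, (u^-1 = a%:E)%E & 0 <= a.
Proof.
case: u => [r| |] //=.
- rewrite lee_fin => r1; have r0 : 0 < r by exact: lt_le_trans ltr01 r1.
  by exists r^-1; rewrite ?inver ?gt_eqF // invr_ge0 ltW.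
- by exists 0; rewrite ?invey.
Qed.

Lemma normL_ge0 (R : realType) (T : finType) (u : \bar R) (f : T -> R) :
  0 <= normL u f.
Proof.
case: u => [r| |] //=; first exact: powR_ge0.
by elim/big_ind: _ => // x y x0 y0; rewrite le_max x0.
Qed.

(* For finite u, H is |f|^u divided by its mean. *)
Lemma normL_majorant (R : realType) (T : finType) (u : \bar R) (a : R)
    (f : T -> R) : (1 <= u)%E -> (u^-1 = a%:E)%E -> (forall x, 0 <= f x) ->
  exists H : T -> R, [/\ forall x, 0 <= H x, \sum_x H x <= #|T|%:R &
    forall x, f x <= normL u f * H x `^ a].
Proof.
move=> u1 ua f0.
(* The zero function is set apart because its mean cannot be divided by. *)
have [fz|[x1 fx1]] : (forall x, f x = 0) \/ (exists x, f x != 0).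
    have [/existsP h|h] := boolP [exists x, f x != 0]; first by right.
    by left=> x; apply/eqP; apply: contraNT h => ?; apply/existsP; exists x.
  exists (fun=> 1); split=> // [|x]; first by rewrite sumr_const.
  by rewrite fz mulr_ge0 ?normL_ge0 ?powR_ge0.
case: u u1 ua => [r| |] //= r1 ra; last first.
  exists (fun=> 1); split=> // [|x]; first by rewrite sumr_const.
  by rewrite powR1 mulr1 -[leLHS]ger0_norm // (le_bigmax _ (fun x => `|f x|)).
have r0 : 0 < r by exact: lt_le_trans ltr01 r1.
move: ra; rewrite inver gt_eqF // => -[<-].
set M := _^-1 * _.
have T0 : 0 < #|T|%:R :> R by rewrite ltr0n; apply/card_gt0P; exists x1.
have M0 : 0 < M.
  rewrite mulr_gt0 ?invr_gt0 // (bigD1 x1) //= ltr_wpDr //.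
    by apply: sumr_ge0 => x _; exact: powR_ge0.
  by rewrite powR_gt0 // normr_gt0.
exists (fun x => `|f x| `^ r / M); split=> [x||x].
- by rewrite divr_ge0 ?powR_ge0 ?ltW.
- rewrite -mulr_suml ler_pdivrMr // /M mulrA divff ?mul1r //; exact: lt0r_neq0.
rewrite -powRM ?divr_ge0 ?powR_ge0 ?(ltW M0) // mulrC divfK ?gt_eqF //.
by rewrite -powRrM divff ?gt_eqF // powRr1 // ger0_norm.
Qed.

Lemma LWform_le (R : realType) (F : finFieldType) (f1 f2 : F * F -> R) A :
  (forall x y, f1 x * f2 y <= A x y) ->
  LWform f1 f2 <=
  (#|F|%:R ^+ 3)^-1 * \sum_(z : heis F) A (hproj1 z) (hproj2 z).
Proof.
by move=> fA; rewrite ler_wpM2l ?invr_ge0 ?exprn_ge0 //; apply: ler_sum.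
Qed.

Lemma LWform_fst (R : realType) (F : finFieldType) (f : F * F -> R) :
  odd #|F| -> LWform f (fun=> 1) = #|F|%:R ^- 2 * \sum_p f p.
Proof.
move=> oF; rewrite LWform_lines //.
under eq_bigr do rewrite mul1r.
have q0 : #|F|%:R != 0 :> R by rewrite gt_eqF ?natr_card_gt0.
by rewrite sum_points_lines; field.
Qed.

Lemma LWform_snd (R : realType) (F : finFieldType) (f : F * F -> R) :
  odd #|F| -> LWform (fun=> 1) f = #|F|%:R ^- 2 * \sum_p f p.
Proof.
move=> oF; rewrite LWform_lines //.
have q0 : #|F|%:R != 0 :> R by rewrite gt_eqF ?natr_card_gt0.
by rewrite sumr_const -mulr_suml; field.
Qed.

Lemma LWbound_uniform (R : realType) (F : finFieldType) (u1 u2 : \bar R)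
    (a b : R) : odd #|F| -> (1 <= u1)%E -> (1 <= u2)%E ->
  (u1^-1 = a%:E)%E -> (u2^-1 = b%:E)%E -> 0 <= a -> 0 <= b ->
  a + 2 * b <= 2 -> 2 * a + b <= 2 -> LWbound F u1 u2 12.
Proof.
move=> oF u1_ge1 u2_ge1 u1a u2b a0 b0 ab1 ab2 f1 f2 f10 f20.
have [H1 [H10 S1 fH1]] := normL_majorant u1_ge1 u1a f10.
have [H2 [H20 S2 fH2]] := normL_majorant u2_ge1 u2b f20.
have N10 := normL_ge0 u1 f1; have N20 := normL_ge0 u2 f2.
set N1 := normL u1 f1 in fH1 N10 *; set N2 := normL u2 f2 in fH2 N20 *.
pose k p := H1 p `^ 3^-1; pose g p := H2 p `^ 3^-1.
have cube (x : R) : 0 <= x -> (x `^ 3^-1) ^+ 3 = x.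
  by move=> x0; rewrite -powR_mulrn ?powR_ge0 // -powRrM mulVf // powRr1.
have q0 : 0 < #|F|%:R :> R by exact: natr_card_gt0.
rewrite card_prod natrM -expr2 in S1 S2.
have LW1 : LWform H1 (fun=> 1) <= 1.
  by rewrite LWform_fst // ler_pdivrMl ?exprn_gt0 // mulr1.
have LW2 : LWform (fun=> 1) H2 <= 1.
  by rewrite LWform_snd // ler_pdivrMl ?exprn_gt0 // mulr1.
have LW0 : @LWform R F (fun=> 1) (fun=> 1) = 1.
  rewrite LWform_fst // sumr_const card_prod natrM.
  by field; exact: lt0r_neq0.
have LW3 : LWform (fun p => k p ^+ 2) (fun p => g p ^+ 2) <= 9.
  apply: LWform_endpoint => //; try by move=> p; exact: powR_ge0.
    by under eq_bigr do rewrite cube //.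
  by under eq_bigr do rewrite cube //.
(* The four corner forms are at most 1, 1, 1 and 9, which gives the constant 12. *)
apply: (@le_trans _ _ (N1 * N2 * (LWform (fun=> 1) (fun=> 1) +
    LWform H1 (fun=> 1) + LWform (fun=> 1) H2 +
    LWform (fun p => k p ^+ 2) (fun p => g p ^+ 2)))); last first.
  have := mulr_ge0 N10 N20; nra.
pose A x y := N1 * N2 * (1 * 1 + H1 x * 1 + 1 * H2 y + k x ^+ 2 * g y ^+ 2).
rewrite [leRHS](_ : _ = (#|F|%:R ^+ 3)^-1 *
    \sum_(z : heis F) A (hproj1 z) (hproj2 z)); last first.
  by rewrite /LWform -!mulrDr -!big_split mulrCA mulr_sumr.
apply: LWform_le => x y.
apply: (@le_trans _ _ (N1 * N2 * (H1 x `^ a * H2 y `^ b))).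
  by rewrite mulrACA ler_pM.
rewrite ler_wpM2l ?mulr_ge0 // !mul1r !mulr1.
exact: powR_quadrilateral_le.
Qed.

(** * Test functions and necessity *)

(** At [u = +oo] the exponent [a] is 0 and the right side is 1, which is the maximum because [A]
    contains [x0]. *)
Lemma normL_indicator (R : realType) (T : finType) (u : \bar R) (a : R)
    (A : {set T}) (x0 : T) : (1 <= u)%E -> (u^-1 = a%:E)%E -> x0 \in A ->
  normL u (fun x => (x \in A)%:R) = (#|T|%:R^-1 * #|A|%:R) `^ a.
Proof.
move=> + + x0A; case: u => [r| |] //=.
- rewrite lee_fin => r1; have r0 : 0 < r by exact: lt_le_trans ltr01 r1.
  rewrite inver gt_eqF // => -[<-]; congr ((_ * _) `^ _).
  under eq_bigr do rewrite ger0_norm //.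
  rewrite (bigID (mem A)) /= [X in _ + X]big1 => [|x /negbTE ->]; last first.
    by rewrite powR0 ?gt_eqF.
  by rewrite addr0 (eq_bigr (fun=> 1)) ?sumr_const // => x ->; rewrite powR1.
- rewrite invey => _ [<-]; rewrite powRr0; apply/eqP; rewrite eq_le.
  apply/andP; split; first by apply: bigmax_le => // x _; rewrite normr_nat; case: (_ \in _).
  by have := le_bigmax 0 (fun x => `|(x \in A)%:R| : R) x0; rewrite x0A normr1.
Qed.

(** Some admissible constant lies below [C + 1], so it need not be shown that the infimum is
    attained. *)
Lemma LW_le_bound (R : realType) (F : finFieldType) (u1 u2 : \bar R) (C : R) :
  (LW F u1 u2 <= C%:E)%E -> LWbound F u1 u2 (C + 1).
Proof.
move=> LWC; have : (LW F u1 u2 < (C + 1)%:E)%E.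
  by apply: le_lt_trans LWC _; rewrite lte_fin ltrDl.
move=> /ereal_inf_lt[_ [A bA <-]]; rewrite lte_fin => AC f1 f2 f10 f20.
apply: le_trans (bA f1 f2 f10 f20) _.
by rewrite !ler_wpM2r ?normL_ge0 // ltW.
Qed.

(** The lines through the origin are those with intercept 0, one for each slope. *)
Lemma LWform_point_lines (R : realType) (F : finFieldType) : odd #|F| ->
  LWform (fun p : F * F => (p \in [set (0 : F, 0 : F)])%:R)
         (fun p : F * F => (p \in [set p | p.2 == 0])%:R) = #|F|%:R ^- 2 :> R.
Proof.
move=> oF; rewrite LWform_lines // sum_pair.
have q0 : #|F|%:R != 0 :> R by rewrite gt_eqF ?natr_card_gt0.
rewrite [X in _ * X](_ : _ = #|F|%:R); first by field.
rewrite -sum1_card natr_sum; apply: eq_bigr => m _.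
rewrite (bigD1 0) //= [X in _ + X]big1 => [|j /negbTE j0]; last first.
  by rewrite inE /= j0 mul0r.
rewrite inE eqxx mul1r addr0 (bigD1 0) //= inE mulr0 addr0 eqxx.
by rewrite big1 ?addr0 // => x /negbTE x0; rewrite inE xpair_eqE x0.
Qed.

Lemma LWform_points_line (R : realType) (F : finFieldType) : odd #|F| ->
  LWform (fun p : F * F => (p \in [set p | p.2 == 0])%:R)
         (fun p : F * F => (p \in [set (0 : F, 0 : F)])%:R) = #|F|%:R ^- 2 :> R.
Proof.
move=> oF; rewrite LWform_lines // (bigD1 (0, 0)) //= inE eqxx mul1r.
rewrite [X in _ + X]big1 => [|l /negbTE l0]; last by rewrite inE l0 mul0r.
under eq_bigr do rewrite inE /= mul0r addr0 eqxx.
have q0 : #|F|%:R != 0 :> R by rewrite gt_eqF ?natr_card_gt0.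
rewrite sumr_const addr0 -[_ *+ _]mulr_natl mulr1 -[#|_|]/#|F|.
by field.
Qed.

Lemma card_axis (F : finFieldType) : #|[set p : F * F | p.2 == 0]| = #|F|.
Proof.
rewrite (_ : [set p | _] = finset.setX [set: F] [set 0 : F]); last first.
  by apply/setP => p; rewrite !inE.
by rewrite cardsX cards1 muln1 cardsT.
Qed.

Lemma powR_primes_bounded (R : realType) (d C : R) :
  (forall p : nat, prime p -> odd p -> p%:R `^ d <= C) -> d <= 0.
Proof.
move=> bd; rewrite leNgt; apply/negP => d0.
(* The shift by 2 forces the prime above [n] to be odd. *)
pose n := (Num.bound (C `^ d^-1)).+2.
have [p np pp] := prime_above n.
have op : odd p by case: (even_prime pp) np => [->|].
have C0 : 0 <= C by apply: le_trans (bd p pp op); exact: powR_ge0.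
have : (p%:R `^ d) `^ d^-1 <= C `^ d^-1.
  by apply: ge0_ler_powR; rewrite ?nnegrE ?powR_ge0 ?invr_ge0 ?(ltW d0) // bd.
rewrite -powRrM divff ?gt_eqF // powRr1 // leNgt => /negP; apply.
apply: lt_trans (archi_boundP (powR_ge0 _ _)) _.
rewrite ltr_nat; apply: leq_trans np; exact: (leq_addl 2).
Qed.

(** In the plane a point has density [q ^- 2] and a pencil of lines density [q^-1]; collecting
    powers of [q] leaves a single exponent. *)
Lemma test_functions_exponent (R : realType) (q a b C : R) : 0 < q ->
  q ^- 2 <= C * ((q ^+ 2)^-1 * 1) `^ a * ((q ^+ 2)^-1 * q) `^ b ->
  q `^ (2 * a + b - 2) <= C.
Proof.
move=> q0; have qN0 : q != 0 by rewrite gt_eqF.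
rewrite mulr1 [X in X `^ b](_ : _ = q^-1); last by field.
rewrite -powR_invn ?(ltW q0) // -powRrM -powR_inv1 ?(ltW q0) // -powRrM -mulrA -powRD; last first.
  by rewrite qN0 implybT.
rewrite -ler_pdivrMr ?powR_gt0 // -powRB; last by rewrite qN0 implybT.
by congr (_ `^ _ <= _); ring.
Qed.

Theorem theorem1p2 (R : realType) (u1 u2 : \bar R)
    (hu1 : (1 <= u1)%E) (hu2 : (1 <= u2)%E) :
  (exists C : R, 0 < C /\
     forall F : finFieldType, odd #|F| -> (LW F u1 u2 <= C%:E)%E)
  <->
  ((u1^-1 + 2%:E * u2^-1 <= 2%:E)%E /\ (2%:E * u1^-1 + u2^-1 <= 2%:E)%E).
Proof.
have [a u1a a0] := inve_ge1 hu1; have [b u2b b0] := inve_ge1 hu2.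
rewrite u1a u2b -!EFinM -!EFinD !lee_fin; split=> [[C [C0 LWC]]|[ab1 ab2]].
  have bound (p : nat) : prime p -> odd p ->
      p%:R `^ (2 * b + a - 2) <= C + 1 /\ p%:R `^ (2 * a + b - 2) <= C + 1.
    move=> pp op; have cF := card_Fp pp.
    have oF : odd #|'F_p| by rewrite cF.
    have p0 : 0 < p%:R :> R by rewrite ltr0n prime_gt0.
    have bC := LW_le_bound (LWC 'F_p oF).
    have ind (A : {set 'F_p * 'F_p}) x : 0 <= (x \in A)%:R :> R by [].
    have Z0 : (0 : 'F_p, 0 : 'F_p) \in [set (0 : 'F_p, 0 : 'F_p)] by rewrite inE.
    have Z1 : (0 : 'F_p, 0 : 'F_p) \in [set p | p.2 == 0] by rewrite inE.
    (* A single line with its points yields [2 * b + a], a single point with its lines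
       [2 * a + b]. *)
    split; apply: test_functions_exponent => //.
      have := bC _ _ (ind [set p | p.2 == 0]) (ind [set (0, 0)]).
      rewrite LWform_points_line // (normL_indicator hu1 u1a Z1).
      rewrite (normL_indicator hu2 u2b Z0) cards1 card_axis card_prod cF natrM.
      by rewrite -expr2 mulrAC.
    have := bC _ _ (ind [set (0, 0)]) (ind [set p | p.2 == 0]).
    rewrite LWform_point_lines // (normL_indicator hu1 u1a Z0).
    by rewrite (normL_indicator hu2 u2b Z1) cards1 card_axis card_prod cF natrM.
  have := @powR_primes_bounded _ (2 * b + a - 2) (C + 1) (fun p pp op => (bound p pp op).1).
  have := @powR_primes_bounded _ (2 * a + b - 2) (C + 1) (fun p pp op => (bound p pp op).2).
  by move=> h1 h2; split; lra.
exists 12; split=> // F oF; apply: ereal_inf_lbound.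
by exists 12 => //; exact: LWbound_uniform u1a u2b _ _ _ _.
Qed.
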